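(* Let $d\ge 2$ and let $(\mathcal{H}_1,\mathcal{H}_2,\dots,\mathcal{H}_d)$ be a $d$-partition of $K_{3d}^3$. The following are equivalent: (1) $det^{S^3}(\omega_{(\mathcal{H}_1,\mathcal{H}_2,\dots,\mathcal{H}_d)})\neq 0$. (2) $(\mathcal{H}_1,\mathcal{H}_2,\dots,\mathcal{H}_d)$ is pre-homogeneous, and $b_q(\mathcal{H}_i)=0$ for every $1\leq i\leq d$ and $-1\leq q\leq 2$. (3) $(\mathcal{H}_1,\mathcal{H}_2,\dots,\mathcal{H}_d)$ is pre-homogeneous, and $b_2(\mathcal{H}_i)=0$ for every $1\leq i\leq d$.
   Context: $k$ is a field of characteristic zero, $\otimes=\otimes_k$, and $V_d$ is a $k$-vector space of dimension $d$ with basis $\{e_1,\dots,e_d\}$. Definition of $det^{S^3}$. Given $v_{i,j,l}\in V_d$ for $1\leq i<j<l\leq 3d$, for each $1\leq m<n\leq 3d$ let $\mathcal{E}_{m,n}$ be the vector equation (with scalar unknowns $\lambda_{i,j,l}$) $$\sum_{r=1}^{m-1}(-1)^{r-1}\lambda_{r,m,n}v_{r,m,n}+\sum_{s=m+1}^{n-1}(-1)^s\lambda_{m,s,n}v_{m,s,n}+\sum_{t=n+1}^{3d}(-1)^{t+1}\lambda_{m,n,t}v_{m,n,t}=0.$$ In the basis $e_1,\dots,e_d$ each $\mathcal{E}_{m,n}$ is a block of $d$ scalar linear equations. Let $A_{3d}((v_{i,j,l}))$ be the $d\binom{3d-1}{2}\times d\binom{3d-1}{2}$ coefficient matrix of the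 system of the equations $\mathcal{E}_{m,n}$ with $1\leq m<n<3d$ (columns indexed by triples, row blocks by pairs, in lexicographic order). Then $det^{S^3}:V_d^{\otimes\binom{3d}{3}}\to k$ is the linear map with $det^{S^3}(\otimes_{1\leq i<j<l\leq 3d}(v_{i,j,l}))=\det(A_{3d}((v_{i,j,l})))$. Hypergraphs. $K_{n}^3$ is the complete $3$-uniform hypergraph with vertex set $\{1,\dots,n\}$, whose hyperedges are all $3$-element subsets. A $d$-partition of $K_{3d}^3$ is an ordered tuple $(\mathcal{H}_1,\dots,\mathcal{H}_d)$ of sub-hypergraphs, each with vertex set $\{1,\dots,3d\}$, whose hyperedge sets $E(\mathcal{H}_i)$ are pairwise disjoint with union the set of all hyperedges of $K_{3d}^3$. The element $\omega_{(\mathcal{H}_1,\dots,\mathcal{H}_d)}\in V_d^{\otimes\binom{3d}{3}}$ is the simple tensor $\otimes_{1\leq i<j<l\leq 3d}(v_{i,j,l})$ with $v_{i,j,l}=e_q$ where $q$ is the unique index with $\{i,j,l\}\in E(\mathcal{H}_q)$. For a sub-hypergraph $\mathcal{H}$ of $K_n^3$ and $1\le s\le 3$, $E_s(\mathcal{H})$ is the set of $s$-element subsets of vertices contained in some hyperedge of $\mathcal{H}$. A $d$-partition of $K_{3d}^3$ is pre-homogeneous if $|E_1(\mathcal{H}_i)|=3d$ and $|E_2(\mathcal{H}_i)|=\frac{3d(3d-1)}{2}$ for all $1\le i\le d$. Betti numbers. Let $l_1,\dots,l_n$ be a basis of $\mathbb{R}^n$. To a sub-hypergraph $\mathcal{H}$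 of $K_n^3$ associate the $2$-dimensional CW (simplicial) complex $X(\mathcal{H})\subseteq\mathbb{R}^n$ whose $(s-1)$-dimensional cells, $s=1,2,3$, are the simplices $\{t_1l_{a_1}+\dots+t_sl_{a_s}\mid t_j\in[0,1],\ \sum_j t_j=1\}$ for $\{a_1,\dots,a_s\}\in E_s(\mathcal{H})$. Then $b_q(\mathcal{H})$ denotes the $q$-th reduced Betti number of $X(\mathcal{H})$, $q\ge -1$ (the dimension of the degree $q$ homology of the augmented chain complex over a field of characteristic zero, with one generator in degree $-1$). *)

(* Defs.v *)
From HB Require Import structures.
From mathcomp Require Import all_boot all_order all_fingroup all_algebra.

Set Implicit Arguments.
Unset Strict Implicit.
Unset Printing Implicit Defensive.

Import GRing.Theory.
Local Open Scope ring_scope.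

(* Vertices are numbered from 0: the vertex a of 'I_n is the vertex a + 1 of
   the set {1, ..., n}. The enumeration of a product of finite types (and of a
   subtype of it) is lexicographic. *)

Definition pair_lt (n : nat) := {p : 'I_n * 'I_n | (p.1 < p.2)%N}.

Definition triple_lt (n : nat) :=
  {t : 'I_n * 'I_n * 'I_n | (t.1.1 < t.1.2 < t.2)%N}.

Section Triples.
Variable n : nat.
Implicit Type t : triple_lt n.

Definition tri1 t : 'I_n := (val t).1.1.
Definition tri2 t : 'I_n := (val t).1.2.
Definition tri3 t : 'I_n := (val t).2.
Definition triset t : {set 'I_n} := [set tri1 t; tri2 t; tri3 t].

End Triples.

Lemma card_pair_lt (n : nat) : #|{: pair_lt n}| = 'C(n, 2).
Proof.
rewrite -card_ltn_sorted_tuples -(card_imset _ (f := fun p : pair_lt n =>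
  [tuple (val p).1; (val p).2])); last first.
  by move=> [[a b] ab] [[c e] ce] /= [? ?]; apply: val_inj; congr (_, _).
apply: eq_card => s; rewrite !inE; apply/imsetP/idP.
  by move=> [[[a b] ab] _ ->] /=; rewrite ab.
case: s => [[|a [|b [|]]]] //= sz; rewrite andbT => ab.
by exists (exist (fun p : 'I_n * 'I_n => p.1 < p.2)%N (a, b) ab) => //; apply: val_inj.
Qed.

Lemma card_triple_lt (n : nat) : #|{: triple_lt n}| = 'C(n, 3).
Proof.
rewrite -card_ltn_sorted_tuples -(card_imset _ (f := fun t : triple_lt n =>
  [tuple tri1 t; tri2 t; tri3 t])); last first.
  move=> [[[a b] c] abc] [[[a' b'] c'] abc'] [? ? ?].
  by apply: val_inj; congr (_, _, _).
apply: eq_card => s; rewrite !inE; apply/imsetP/idP.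
  by move=> [[[[a b] c] abc] _ ->] /=; rewrite andbT.
case: s => [[|a [|b [|c [|]]]]] //= sz; rewrite andbT => abc.
exists (exist (fun t : 'I_n * 'I_n * 'I_n => t.1.1 < t.1.2 < t.2)%N (a, b, c) abc) => //.
exact: val_inj.
Qed.

Section DetS3.
Variables (k : fieldType) (d : nat).

Definition sizeA : nat := (d * 'C(3 * d - 1, 2))%N.

Lemma card_rowsA : #|{: pair_lt (3 * d - 1) * 'I_d}| = sizeA.
Proof. by rewrite card_prod card_pair_lt card_ord mulnC. Qed.

Lemma card_colsA : #|{: triple_lt (3 * d)}| = sizeA.
Proof.
rewrite card_triple_lt /sizeA; case: d => [|d'] //.
have := mul_bin_diag (3 * d'.+1) 2; rewrite -subn1 -mulnA => /eqP.
by rewrite eqn_pmul2l // => /eqP ->.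
Qed.

Definition rowA (r : 'I_sizeA) : pair_lt (3 * d - 1) * 'I_d :=
  enum_val (cast_ord (esym card_rowsA) r).

Definition colA (c : 'I_sizeA) : triple_lt (3 * d) :=
  enum_val (cast_ord (esym card_colsA) c).

(* The coefficient of lambda_t v_t in the equation E_{m,n}, for m < n. With
   1-based indices r, s, t the signs are (-1)^(r-1), (-1)^s and (-1)^(t+1). *)
Definition coefE (m n : nat) (t : triple_lt (3 * d)) : k :=
  if (tri2 t == m :> nat) && (tri3 t == n :> nat) then (-1) ^+ tri1 t
  else if (tri1 t == m :> nat) && (tri3 t == n :> nat) then (-1) ^+ (tri2 t).+1
  else if (tri1 t == m :> nat) && (tri2 t == n :> nat) then (-1) ^+ (tri3 t).+2
  else 0.

Definition matA (v : triple_lt (3 * d) -> 'cV[k]_d) : 'M[k]_sizeA :=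
  \matrix_(r, c) (let: (p, q) := rowA r in
    coefE (val p).1 (val p).2 (colA c) * v (colA c) q 0).

(* The tensor power of k^d over the index set triple_lt (3 * d), in coordinates
   with respect to the basis of tensors of the standard basis vectors. *)
Definition tensor_power := {ffun {ffun triple_lt (3 * d) -> 'I_d} -> k^o}.

Definition pure_tensor (v : triple_lt (3 * d) -> 'cV[k]_d) : tensor_power :=
  [ffun f : {ffun triple_lt (3 * d) -> 'I_d} => \prod_t v t (f t) 0].

Definition basis_vec (q : 'I_d) : 'cV[k]_d := delta_mx q 0.

(* The linear map with prescribed values on the basis tensors; detS3_pure is
   its characterization on all simple tensors. *)
Definition detS3 (x : tensor_power) : k^o :=
  \sum_f x f * \det (matA (fun t => basis_vec (f t))).

Lemma detS3_is_linear : linear detS3.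
Proof.
move=> a x y; rewrite /detS3 scaler_sumr -big_split; apply: eq_bigr => f _.
by rewrite !ffunE mulrDl scalerAl.
Qed.

HB.instance Definition _ :=
  GRing.isLinear.Build k tensor_power k^o _ detS3 detS3_is_linear.

Lemma detS3_pure (v : triple_lt (3 * d) -> 'cV[k]_d) :
  detS3 (pure_tensor v) = \det (matA v).
Proof.
have cI : bijective colA.
  exists (fun t => cast_ord card_colsA (enum_rank t)) => x.
    by rewrite /colA enum_valK cast_ordKV.
  by rewrite /colA cast_ordK enum_rankK.
rewrite /detS3 -[RHS]det_tr.
under eq_bigr => f _ do rewrite -det_tr mulr_sumr.
rewrite exchange_big; apply: eq_bigr => s _ /=.
under eq_bigr => f _ do rewrite mulrCA.
rewrite -mulr_sumr; congr (_ * _).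
pose g c (q : 'I_d) : k := let: (p, q') := rowA (s c) in
  coefE (val p).1 (val p).2 (colA c) * (v (colA c) q 0 * (q' == q)%:R).
transitivity (\prod_c \sum_q g c q).
  have [h hK Kh] := cI.
  rewrite [RHS](reindex h) /=; last by exists colA => ? _.
  rewrite bigA_distr_bigA /=; apply: eq_bigr => f _.
  rewrite ffunE [X in _ * X](reindex h) /=; last by exists colA => ? _.
  rewrite -big_split; apply: eq_bigr => t _ /=.
  rewrite !mxE /g Kh; case: (rowA _) => p q /=.
  by rewrite !mxE eqxx andbT mulrCA.
apply: eq_bigr => c _; rewrite !mxE /g; case: (rowA _) => p q.
rewrite -mulr_sumr (bigD1 q) //= eqxx mulr1 big1 ?addr0 // => q' /negPf.
by rewrite eq_sym => ->; rewrite mulr0.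
Qed.

End DetS3.

Section Hypergraphs.
Variable n : nat.

(* All sub-hypergraphs of K_n^3 considered have vertex set 'I_n, so they are
   represented by their sets of hyperedges. *)
Definition complete3 : {set {set 'I_n}} := [set S : {set 'I_n} | #|S| == 3%N].

Definition Eset (s : nat) (H : {set {set 'I_n}}) : {set {set 'I_n}} :=
  [set S : {set 'I_n} | (#|S| == s) && [exists T in H, S \subset T]].

(* Generators of the augmented chain complex in degree s - 1; the one of
   degree -1 is present even if H has no hyperedge. *)
Definition faces (H : {set {set 'I_n}}) (s : nat) : {set {set 'I_n}} :=
  if s is 0 then [set set0] else Eset s H.

End Hypergraphs.

Section Betti.
Variables (k : fieldType) (n : nat) (H : {set {set 'I_n}}).

(* The coefficient of S' in the boundary of the simplex S with its vertices in
   increasing order. *)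
Definition incidence (S S' : {set 'I_n}) : k :=
  \sum_(v in S | S :\ v == S') (-1) ^+ #|[set u in S | (u < v)%N]|.

(* From degree s to degree s - 1, acting on row vectors. *)
Definition boundary (s : nat) : 'M[k]_(#|faces H s.+1|, #|faces H s|) :=
  \matrix_(i, j) incidence (enum_val i) (enum_val j).

(* dim_cycles s and homology_dim s concern degree s - 1. *)
Definition dim_cycles (s : nat) : nat :=
  if s is s'.+1 then \rank (kermx (boundary s')) else #|faces H 0|.

Definition homology_dim (s : nat) : nat :=
  (dim_cycles s - \rank (boundary s))%N.

Lemma boundary_boundary (s : nat) : boundary s.+1 *m boundary s = 0.
Proof.
apply/matrixP => i j; rewrite !mxE.
set S := enum_val i; set S' := enum_val j.
have SE : S \in faces H s.+2 by apply: enum_valP.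
have Sv v : v \in S -> S :\ v \in faces H s.+1.
  move: SE; rewrite !inE => /andP[/eqP cS /existsP[T /andP[TH sST]]] vS.
  have := cardsD1 v S; rewrite cS vS add1n => -[<-]; rewrite eqxx.
  apply/existsP; exists T; rewrite TH.
  by apply: subset_trans sST; apply: subsetDl.
pose pos (X : {set 'I_n}) (v : 'I_n) := #|[set u in X | (u < v)%N]|.
pose f (v w : 'I_n) : k := if [&& v \in S, w \in S, w != v & S :\ v :\ w == S']
  then (-1) ^+ pos S v * (-1) ^+ pos (S :\ v) w else 0.
transitivity (\sum_v \sum_w f v w).
  under eq_bigr => r _ do rewrite !mxE /incidence -/S -/S' mulr_suml big_mkcond.
  rewrite exchange_big; apply: eq_bigr => v _ /=.
  case vS: (v \in S); last first.
    by rewrite !big1 // => w _; rewrite /f vS.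
  rewrite (bigD1 (enum_rank_in (Sv v vS) (S :\ v))) //=.
  rewrite enum_rankK_in ?Sv // eqxx [X in _ + X]big1 ?addr0; last first.
    move=> r nr; case: (S :\ v =P enum_val r) => // Er; case/negP: nr; apply/eqP.
    by apply: enum_val_inj; rewrite enum_rankK_in ?Sv // -Er.
  rewrite mulr_sumr big_mkcond; apply: eq_bigr => w _.
  by rewrite /f vS !inE; case: (w \in S); case: (w != v); rewrite ?andbF.
have fA (v w : 'I_n) : (v < w)%N -> f w v = - f v w.
  move=> vw; rewrite /f; have nvw : v != w by rewrite neq_ltn vw.
  rewrite nvw (eq_sym w) nvw /= andbCA !setDDl [[set w] :|: _]setUC.
  case: ifP => [/and3P[vS wS _]|]; last by rewrite oppr0.
  have -> : pos (S :\ w) v = pos S v.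
    apply: eq_card => u; rewrite !inE.
    by case: eqP => [->|//]; rewrite (ltnNge w) (ltnW vw) !andbF.
  have -> : pos S w = (pos (S :\ v) w).+1.
    rewrite /pos (cardsD1 v) inE vS vw add1n; congr _.+1.
    by apply: eq_card => u; rewrite !inE andbA.
  by rewrite exprS mulN1r mulNr mulrC.
rewrite pair_big (bigID (fun p : 'I_n * 'I_n => p.1 < p.2)%N) /=.
rewrite [X in _ + X](bigID (fun p : 'I_n * 'I_n => p.2 < p.1)%N) /=.
rewrite [X in _ + (_ + X)]big1 ?addr0; last first.
  move=> [v w] /=; rewrite -!leqNgt => /andP[wv vw].
  have -> : w = v by apply/val_inj/anti_leq; rewrite wv vw.
  by rewrite /f eqxx !andbF.
rewrite [X in _ + X](reindex_inj (h := fun p : 'I_n * 'I_n => (p.2, p.1))) /=;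
  last by move=> [a b] [a' b'] [-> ->].
rewrite -[X in X + _]opprK -sumrN addrC.
rewrite [X in X - _](eq_bigl (fun p : 'I_n * 'I_n => p.1 < p.2)%N) /=.
  apply/eqP; rewrite subr_eq0; apply/eqP; apply: eq_bigr => p; exact: fA.
by move=> [v w] /=; case: ltngtP.
Qed.

(* The q-th reduced Betti number, over k. *)
Definition betti (q : int) : nat :=
  match q with
  | Posz q' => homology_dim q'.+1
  | Negz 0 => homology_dim 0
  | Negz _.+1 => 0
  end.

End Betti.

Section Partitions.
Variable d : nat.
Implicit Type H : 'I_d -> {set {set 'I_(3 * d)}}.

Definition is_dpartition H : Prop :=
  (forall i j : 'I_d, i != j -> [disjoint H i & H j]) /\
  \bigcup_i H i = complete3 (3 * d).

Definition pre_homogeneous H : Prop :=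
  forall i : 'I_d, #|Eset 1 (H i)| = (3 * d)%N /\
                   #|Eset 2 (H i)| = (3 * d * (3 * d - 1) %/ 2)%N.

(* In a d-partition the index picked exists and is unique. *)
Definition omega_vec (k : fieldType) H (t : triple_lt (3 * d)) : 'cV[k]_d :=
  if [pick q | triset t \in H q] is Some q then basis_vec k q else 0.

Definition omega (k : fieldType) H : tensor_power k d :=
  pure_tensor (omega_vec k H).

End Partitions.

(* Main.v *)
(* Up to signs on its rows and columns, A is block diagonal after sorting the
   hyperedges by part: the q-th block is the matrix of the boundary map from the
   hyperedges of H_q to the edges avoiding the last vertex. Since the boundary
   of a 2-chain is a cycle, it vanishes as soon as its coefficients on the edges
   avoiding some fixed vertex b do; hence det A <> 0 iff every boundary map d_2
   is injective, i.e. iff b_2(H_q) = 0 for all q. In that case H_q has at most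
   as many hyperedges as there are edges of E_2(H_q) avoiding b, for every b.
   Summing over q, all these bounds are equalities, with value C(3d-1, 2); so an
   edge missing from E_2(H_q) would contradict the bound at a vertex b outside
   of it. The remaining Betti numbers vanish by counting ranks. *)
Require Import Defs.
From mathcomp Require Import all_boot all_order all_algebra.

Set Implicit Arguments.
Unset Strict Implicit.
Unset Printing Implicit Defensive.

Import GRing.Theory.
Local Open Scope ring_scope.

(** * Linear independence of rows indexed by finite sets *)

Definition family_free (k : fieldType) (I J : finType) (F : {set I})
    (G : {set J}) (f : I -> J -> k) : Prop :=
  forall y : I -> k, (forall j, j \in G -> \sum_(i in F) y i * f i j = 0) ->
  forall i, i \in F -> y i = 0.

Lemma sum_codom (V : nmodType) (I K : finType) (F : {set I}) (g : K -> I)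
    (y : I -> V) : injective g -> codom g =i F ->
  \sum_(i in F) y i = \sum_c y (g c).
Proof.
move=> g_inj gF; rewrite -(eq_bigl _ _ gF) -big_uniq; last exact/injectiveP.
by rewrite /codom big_image.
Qed.

Lemma codom_enum_val (T : finType) (A : {set T}) :
  codom (fun i : 'I_#|A| => enum_val i) =i A.
Proof.
move=> x; apply/codomP/idP => [[i ->]|Ax]; first exact: enum_valP.
by exists (enum_rank_in Ax x); rewrite enum_rankK_in.
Qed.

(** The matrices [boundary] and [matA] enumerate simplices in different ways, so they are compared
    through families indexed by the simplices themselves. Repeated columns do not change the left
    kernel, hence only the image of [h] matters. *)
Lemma row_freeE (k : fieldType) (I J : finType) (F : {set I}) (G : {set J})
    (f : I -> J -> k) (m p : nat) (g : 'I_m -> I) (h : 'I_p -> J) :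
    injective g -> codom g =i F -> codom h =i G ->
  row_free (\matrix_(i, j) f (g i) (h j)) <-> family_free F G f.
Proof.
move=> g_inj gF hG; set M := \matrix_(i, j) _.
have sumF (y : I -> k) j :
    \sum_(i in F) y i * f i (h j) = ((\row_i y (g i)) *m M) 0 j.
  rewrite (sum_codom _ g_inj gF) mxE.
  by apply: eq_bigr => i _; rewrite !mxE.
split=> [freeM y y0 i | freeF].
  have /eqP : (\row_i y (g i)) *m M = 0.
    apply/rowP => j; rewrite -sumF y0 ?mxE // -hG; exact: codom_f.
  rewrite mulmx_free_eq0 // -gF => /eqP/rowP y_g /codomP[c ->].
  by have := y_g c; rewrite !mxE.
apply: inj_row_free => v vM.
(* Transports [v] along [g]: the sum has a single term on the image of [g], which is injective, and
   is empty elsewhere. *)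
pose y i := \sum_(c | g c == i) v 0 c.
have yg c : y (g c) = v 0 c.
  by rewrite /y (eq_bigl (pred1 c)) ?big_pred1_eq // => c'; apply: inj_eq.
have v_row : v = \row_c y (g c) by apply/rowP => c; rewrite mxE yg.
apply/rowP => c; rewrite mxE -yg; apply: freeF; last by rewrite -gF codom_f.
by move=> j; rewrite -hG => /codomP[c' ->]; rewrite sumF -v_row vM mxE.
Qed.

(** * Incidence numbers and the identity d d = 0 *)

Section Incidence.
Variables (k : fieldType) (n : nat).
Implicit Types S P T : {set 'I_n}.

Lemma incidenceD1 S v : v \in S ->
  incidence k S (S :\ v) = (-1) ^+ #|[set u in S | (u < v)%N]|.
Proof.
move=> vS; rewrite /incidence (big_pred1 v) // => u; apply/andP/eqP.
  case=> uS /eqP eSuv; apply/eqP/negPn/negP => nuv.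
  by move/setP/(_ u): eSuv; rewrite !inE eqxx nuv uS.
by move=> ->; rewrite vS eqxx.
Qed.

Lemma incidence_sub S P : incidence k S P != 0 -> P \subset S.
Proof.
apply: contraNT => nsub; rewrite /incidence big_pred0 // => v.
by apply/negP => /andP[_ /eqP eP]; rewrite -eP subD1set in nsub.
Qed.

Lemma faces_setT s :
  faces [set: {set 'I_n}] s = [set S : {set 'I_n} | #|S| == s].
Proof.
case: s => [|s]; apply/setP => S; rewrite !inE ?cards_eq0 //.
apply/andP/idP => [[]//|cS]; split=> //; apply/existsP; exists S.
by rewrite inE subxx.
Qed.

(** [boundary_boundary] applied to the full simplex, where every set of the right size is a face,
    becomes an identity between incidence numbers that mentions no hypergraph. *)
Lemma incidence_incidence s T S : #|T| = s.+2 -> #|S| = s ->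
  \sum_(P : {set 'I_n} | #|P| == s.+1) incidence k T P * incidence k P S = 0.
Proof.
move=> cT cS.
have Tf : T \in faces [set: {set 'I_n}] s.+2 by rewrite faces_setT inE cT.
have Sf : S \in faces [set: {set 'I_n}] s by rewrite faces_setT inE cS.
have /matrixP/(_ (enum_rank_in Tf T) (enum_rank_in Sf S)) :=
  boundary_boundary k [set: {set 'I_n}] s.
rewrite !mxE => bb0; rewrite -[RHS]bb0.
rewrite (eq_bigl (fun P => P \in faces [set: {set 'I_n}] s.+1)).
  rewrite (sum_codom _ enum_val_inj (codom_enum_val _)).
  by apply: eq_bigr => i _; rewrite !mxE !enum_rankK_in.
by move=> P; rewrite faces_setT inE.
Qed.

(* In d(dc) = 0 at P :\ b, every face but P of the simplices around P :\ b
   avoids b. *)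
Lemma boundary_away_from_vertex s (F : {set {set 'I_n}}) (y : {set 'I_n} -> k)
    (b : 'I_n) (z := fun P => \sum_(T in F) y T * incidence k T P) :
    (forall T, T \in F -> #|T| = s.+2) ->
    (forall P, #|P| = s.+1 -> b \notin P -> z P = 0) ->
  forall P, #|P| = s.+1 -> z P = 0.
Proof.
move=> cF z0 P cP; case: (boolP (b \in P)) => [bP|]; last exact: z0.
have cS : #|P :\ b| = s by move: cP; rewrite (cardsD1 b) bP => -[].
have : \sum_(Q : {set 'I_n} | #|Q| == s.+1) z Q * incidence k Q (P :\ b) = 0.
  under eq_bigr do rewrite mulr_suml.
  rewrite exchange_big big1 //= => T TF.
  under eq_bigr do rewrite -mulrA.
  by rewrite -mulr_sumr (incidence_incidence (cF T TF)) ?mulr0.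
rewrite (bigD1 P) ?cP //= big1 ?addr0 => [|Q /andP[/eqP cQ nQP]].
  by move/eqP; rewrite mulf_eq0 incidenceD1 // signr_eq0 orbF => /eqP.
case: (boolP (b \in Q)) => [bQ|bQ]; last by rewrite z0 ?mul0r.
apply/eqP; rewrite mulf_eq0 orbC; case: eqP => //= /eqP/incidence_sub sub.
case/eqP: nQP; apply/eqP; rewrite eq_sym eqEcard cP cQ leqnn andbT.
by rewrite -(setD1K bP) subUset sub1set bQ.
Qed.

End Incidence.

(** * Ranks of boundary maps and reduced Betti numbers *)

Section Complexes.
Variables (k : fieldType) (n : nat).
Implicit Types (H F : {set {set 'I_n}}) (P S T : {set 'I_n}).

Lemma family_free_card (I J : finType) (F : {set I}) (G : {set J})
    (f : I -> J -> k) : family_free F G f -> (#|F| <= #|G|)%N.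
Proof.
move/(row_freeE f enum_val_inj (codom_enum_val F) (codom_enum_val G)).
by move/eqP <-; apply: rank_leq_col.
Qed.

Lemma faces_uniform H s :
  (forall T, T \in H -> #|T| = s.+1) -> faces H s.+1 = H.
Proof.
move=> cH; apply/setP => S; rewrite inE; apply/andP/idP => [|SH].
  case=> /eqP cS /exists_inP[T TH sST]; suff -> : S = T by [].
  by apply/eqP; rewrite eqEcard sST cS (cH T TH) leqnn.
by rewrite (cH S SH) eqxx; split=> //; apply/exists_inP; exists S.
Qed.

Lemma boundary_notin_Eset H (y : {set 'I_n} -> k) P :
  P \notin Eset #|P| H -> \sum_(T in H) y T * incidence k T P = 0.
Proof.
move=> nP; apply: big1 => T TH; apply/eqP; rewrite mulf_eq0 orbC.
case: eqP => //= /eqP/incidence_sub sPT; case/negP: nP.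
by rewrite inE eqxx; apply/exists_inP; exists T.
Qed.

(** The equations at faces through [b] follow from those at faces avoiding [b] by
    [boundary_away_from_vertex]; sets outside [Eset] satisfy theirs trivially. The last vertex as
    [b] gives the link with A, and varying [b] gives the counting bounds. *)
Lemma row_free_boundaryP H s (b : 'I_n) :
    (forall T, T \in H -> #|T| = s.+2) ->
  row_free (boundary k H s.+1) <->
  family_free H [set P in Eset s.+1 H | b \notin P] (@incidence k n).
Proof.
move=> cH.
have rfE : row_free (boundary k H s.+1) <->
    family_free H (Eset s.+1 H) (@incidence k n).
  rewrite -[X in family_free X](faces_uniform cH); apply: row_freeE.
  - exact: enum_val_inj.
  - exact: codom_enum_val.
  - exact: codom_enum_val.
apply: (iff_trans rfE); split=> freeH y y0; apply: freeH => P; last first.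
  by rewrite !inE => /andP[PE _]; apply: y0; rewrite inE.
move=> PE; have cP : #|P| = s.+1 by move: PE; rewrite inE => /andP[/eqP].
apply: (boundary_away_from_vertex (b := b) cH) cP => Q cQ bQ.
case: (boolP (Q \in Eset s.+1 H)) => QE; first by apply: y0; rewrite inE QE.
by apply: boundary_notin_Eset; rewrite cQ.
Qed.

Lemma Eset_full H s :
  #|Eset s H| = 'C(n, s) -> Eset s H = [set S : {set 'I_n} | #|S| == s].
Proof.
move=> cE; apply/eqP; rewrite eqEcard cE -[in 'C(_, _)](card_ord n) card_draws.
by rewrite leqnn andbT; apply/subsetP => S; rewrite !inE => /andP[].
Qed.

(** A hyperedge has only three vertices, so [boundary k H 3] has no rows and b_2 is the nullity of
    [boundary k H 2]. *)
Lemma betti2_eq0 H : H \subset complete3 n ->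
  betti k H 2 = 0%N <-> row_free (boundary k H 2).
Proof.
move=> /subsetP cH.
have {}cH T : T \in H -> #|T| = 3 by move/cH; rewrite inE => /eqP.
have -> : betti k H 2 = (#|faces H 3| - \rank (boundary k H 2))%N.
  rewrite -[LHS]/(\rank (kermx (boundary k H 2)) - \rank (boundary k H 3))%N.
  rewrite mxrank_ker; suff -> : \rank (boundary k H 3) = 0%N by rewrite subn0.
  apply/eqP; rewrite -leqn0; apply: leq_trans (rank_leq_row _) _.
  rewrite leqn0 cards_eq0; apply/set0Pn => -[S].
  rewrite inE => /andP[/eqP cS /exists_inP[T /cH cT /subset_leq_card]].
  by rewrite cS cT.
by rewrite -row_leq_rank -subn_eq0; split=> /eqP.
Qed.

Lemma bettiN1_eq0 H : Eset 1 H != set0 -> betti k H (-1) = 0%N.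
Proof.
case/set0Pn => S SE; change (#|faces H 0| - \rank (boundary k H 0) = 0)%N.
apply/eqP; rewrite subn_eq0 [X in (X <= _)%N]cards1 lt0n mxrank_eq0.
apply/negP => /eqP/matrixP.
have f0 : set0 \in faces H 0 by rewrite inE.
move/(_ (enum_rank_in SE S) (enum_rank_in f0 set0)); rewrite !mxE.
rewrite !enum_rankK_in // => /eqP.
have /cards1P[v ->] : #|S| == 1%N by move: SE; rewrite inE => /andP[].
(* The boundary of a vertex is the generator of degree -1 up to sign, so [boundary k H 0] is
   nonzero. *)
by rewrite -[set0](setDv [set v]) incidenceD1 ?set11 // signr_eq0.
Qed.

Lemma incidence_edge (u v : 'I_n) : (u < v)%N ->
  incidence k [set u; v] [set u] = -1 /\ incidence k [set u; v] [set v] = 1.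
Proof.
move=> uv; have nuv : u != v by rewrite neq_ltn uv.
have Du : [set u; v] :\ v = [set u].
  by rewrite setUC setU1K // inE eq_sym.
have Dv : [set u; v] :\ u = [set v] by rewrite setU1K // inE.
split; [rewrite -[X in incidence _ _ X]Du | rewrite -[X in incidence _ _ X]Dv];
  rewrite incidenceD1 ?set21 ?set22 //.
- have -> : [set w in [set u; v] | (w < v)%N] = [set u].
    apply/setP => w; rewrite !inE; case: eqP => [-> //|_].
    by case: eqP => // ->; rewrite ltnn.
  by rewrite cards1 expr1.
- have -> : [set w in [set u; v] | (w < u)%N] = set0.
    apply/setP => w; rewrite !inE; case: eqP => [->|_]; first by rewrite ltnn.
    by case: eqP => // ->; rewrite ltnNge ltnW.
  by rewrite cards0 expr0.
Qed.

(* The transpose of d_1 only kills the constants. *)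
Lemma rank_boundary1 H : (0 < n)%N ->
    Eset 1 H = [set S : {set 'I_n} | #|S| == 1] ->
    Eset 2 H = [set S : {set 'I_n} | #|S| == 2] ->
  (n - 1 <= \rank (boundary k H 1))%N.
Proof.
move=> n_gt0 E1 E2; set M := boundary k H 1.
have S1 v : [set v] \in Eset 1 H by rewrite E1 inE cards1.
have E1P S : S \in Eset 1 H -> exists v, S = [set v].
  by rewrite E1 inE => /cards1P.
have cE1 : #|Eset 1 H| = n by rewrite E1 card_draws card_ord bin1.
have ker_const : (kermx M^T <= (const_mx 1 : 'rV[k]_#|Eset 1 H|))%MS.
  apply/row_subP => i; set x := row i _.
  have xM : x *m M^T = 0 by rewrite -row_mul mulmx_ker row0.
  pose r v := enum_rank_in (S1 v) [set v].
  (* The equation at the edge uv reads x_v - x_u = 0; as every pair is an edge, x is constant on the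
     vertices. *)
  have x_lt (u v : 'I_n) : (u < v)%N -> x 0 (r u) = x 0 (r v).
    move=> uv; have nuv : u != v by rewrite neq_ltn uv.
    have S2 : [set u; v] \in Eset 2 H by rewrite E2 inE cards2 nuv.
    have /rowP/(_ (enum_rank_in S2 [set u; v])) := xM.
    rewrite !mxE (bigD1 (r u)) //= (bigD1 (r v)) /=; last first.
      apply: contra nuv => /eqP/(congr1 enum_val).
      by rewrite !enum_rankK_in // => /set1_inj ->.
    rewrite big1 ?addr0 => [|j /andP[nju njv]].
      rewrite !mxE !enum_rankK_in //; [| exact: S1 | exact: S1].
      have [-> ->] := incidence_edge uv.
      by rewrite mulrN1 mulr1 => /eqP; rewrite addrC subr_eq0 => /eqP.
    rewrite [X in _ * X]mxE [X in _ * X]mxE enum_rankK_in //.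
    apply/eqP; rewrite mulf_eq0 orbC.
    have [w ew] := E1P _ (enum_valP j).
    case: eqP => //= /eqP/incidence_sub; rewrite ew sub1set !inE.
    case/orP => /eqP ewu; [case/eqP: nju | case/eqP: njv];
      by apply: enum_val_inj; rewrite ew enum_rankK_in // ewu.
  pose o := Ordinal n_gt0.
  have -> : x = x 0 (r o) *: const_mx 1; last exact: scalemx_sub.
  apply/rowP => j; rewrite [RHS]mxE [X in _ * X]mxE mulr1.
  have [w ew] := E1P _ (enum_valP j).
  have -> : j = r w by apply: enum_val_inj; rewrite enum_rankK_in.
  by case: (ltngtP o w) => [/x_lt|/x_lt|/val_inj] ->.
(* The kernel lies in a line, so by rank-nullity n minus the rank of M is at most 1. *)
have /mxrankS := ker_const; rewrite mxrank_ker mxrank_tr rank_rV.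
rewrite [X in (X - _ <= _)%N]cE1 => le1.
by rewrite leq_subLR addnC -leq_subLR (leq_trans le1) ?leq_b1.
Qed.

(** The boundary maps d_0, d_1 and d_2 have ranks at least 1, at least n - 1 and exactly C(n-1, 2).
    By rank-nullity and Pascal's rule the cycles in degrees 0 and 1 have dimension at most n - 1 and
    C(n-1, 2). Since [homology_dim] is a truncated subtraction, these inequalities suffice. *)
Lemma betti_acyclic H (q : int) : (0 < n)%N -> H \subset complete3 n ->
    Eset 1 H = [set S : {set 'I_n} | #|S| == 1] ->
    Eset 2 H = [set S : {set 'I_n} | #|S| == 2] ->
    #|H| = 'C(n - 1, 2) -> row_free (boundary k H 2) ->
  -1 <= q <= 2 -> betti k H q = 0%N.
Proof.
move=> n_gt0 sH E1 E2 cH freeH.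
have rk0 : (0 < \rank (boundary k H 0))%N.
  have : betti k H (-1) = 0%N.
    apply: bettiN1_eq0; rewrite E1; apply/set0Pn; exists [set Ordinal n_gt0].
    by rewrite inE cards1.
  rewrite -[LHS]/(#|faces H 0| - \rank (boundary k H 0))%N.
  by move/eqP; rewrite subn_eq0 [X in (X <= _)%N]cards1.
have rk1 := rank_boundary1 n_gt0 E1 E2.
have rk2 : \rank (boundary k H 2) = 'C(n - 1, 2).
  rewrite -cH (eqP freeH) (faces_uniform (s := 2)) // => T /(subsetP sH).
  by rewrite inE => /eqP.
have c1 : #|faces H 1| = n by rewrite /= E1 card_draws card_ord bin1.
have c2 : #|faces H 2| = 'C(n, 2) by rewrite /= E2 card_draws card_ord.
have binE : 'C(n, 2) = ('C(n - 1, 2) + (n - 1))%N.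
  by rewrite -(prednK n_gt0) subn1 /= binS bin1.
case: q => [[|[|[|q]]]|[|q]] // _.
- apply/eqP; rewrite /betti /homology_dim /dim_cycles mxrank_ker.
  rewrite subn_eq0 [X in (X - _ <= _)%N]c1; apply: leq_trans rk1.
  exact: leq_sub2l.
- apply/eqP; rewrite /betti /homology_dim /dim_cycles mxrank_ker.
  rewrite subn_eq0 [X in (X - _ <= _)%N]c2 rk2 binE.
  by rewrite leq_subLR addnC leq_add2r.
- exact/betti2_eq0.
- by apply: bettiN1_eq0; rewrite -card_gt0 c1.
Qed.

End Complexes.

(** * Increasing triples as 3-element sets, and signs *)

Section Triples.
Variables (k : fieldType) (n : nat).

Lemma set2_ltn_eq (a b a' b' : 'I_n) : (a < b)%N -> (a' < b')%N ->
  ([set a; b] == [set a'; b']) = (a == a') && (b == b').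
Proof.
move=> ab ab'; apply/eqP/andP => [eS|[/eqP-> /eqP->] //].
have := set21 a b; have := set22 a b; rewrite eS !inE.
have := set21 a' b'; have := set22 a' b'; rewrite -eS !inE.
case/orP=> /eqP eb' /orP[]/eqP ea' /orP[]/eqP eb /orP[]/eqP ea; subst => //;
  by move: ab ab'; rewrite ?ltnn // => /ltnW; rewrite leqNgt => /negP.
Qed.

(** The diagonal scaling of rows and columns that turns the coefficients of A into incidence
    numbers, as [coefE_incidence] shows. *)
Definition vertex_sign (S : {set 'I_n}) : k :=
  \prod_(v in S) (-1) ^+ v.

Lemma vertex_sign_neq0 (S : {set 'I_n}) : vertex_sign S != 0.
Proof. by apply/prodf_neq0 => v _; rewrite signr_eq0. Qed.

Lemma big_set3 (a b c : 'I_n) (A : Type) (x : A)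
    (op : Monoid.com_law x) (f : 'I_n -> A) : (a < b)%N -> (b < c)%N ->
  \big[op/x]_(v in [set a; b; c]) f v = op (f a) (op (f b) (f c)).
Proof.
move=> ab bc; have ac := ltn_trans ab bc; rewrite -setUA.
rewrite big_setU1 ?inE ?negb_or ?neq_ltn ?ab ?ac //=.
by rewrite big_setU1 ?big_set1 ?inE ?neq_ltn ?bc.
Qed.

Lemma incidence_triple (a b c : 'I_n) P : (a < b)%N -> (b < c)%N ->
  incidence k [set a; b; c] P =
    ([set b; c] == P)%:R - ([set a; c] == P)%:R + ([set a; b] == P)%:R.
Proof.
move=> ab bc; have ac := ltn_trans ab bc.
have nab : a != b by rewrite neq_ltn ab.
have nbc : b != c by rewrite neq_ltn bc.
have nac : a != c by rewrite neq_ltn ac.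
rewrite /incidence big_mkcondr big_set3 //=.
have -> : [set a; b; c] :\ a = [set b; c].
  by rewrite -setUA setU1K // !inE negb_or nab.
have -> : [set a; b; c] :\ b = [set a; c].
  by rewrite (setUC [set a]) -setUA setU1K // !inE negb_or eq_sym nab.
have -> : [set a; b; c] :\ c = [set a; b].
  by rewrite setUC setU1K // !inE negb_or eq_sym nac eq_sym.
have cardlt v : #|[set u in [set a; b; c] | (u < v)%N]| =
    ((a < v) + (b < v) + (c < v))%N.
  rewrite -sum1_card; under eq_bigl do rewrite inE.
  by rewrite big_mkcondr big_set3 //=; do !case: ifP.
rewrite !cardlt !ltnn ab ac bc !(ltnNge _ a) !(ltnNge c) (ltnW ab) (ltnW bc).
rewrite (ltnW ac) /= expr0 expr1 expr2 mulrNN mulr1 -addrA.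
by do !case: ifP => _; rewrite ?oppr0.
Qed.

Lemma tri_ltn (t : triple_lt n) :
  (tri1 t < tri2 t)%N /\ (tri2 t < tri3 t)%N.
Proof. by case: t => [[[a b] c] abc]; apply/andP. Qed.

Lemma codom_triset : codom (@triset n) =i complete3 n.
Proof.
have mem3 (a b c : 'I_n) : (a < b < c)%N -> [set a; b; c] \in codom (@triset n).
  by move=> abc; apply/codomP; exists (exist _ (a, b, c) abc).
move=> S; rewrite inE; apply/idP/idP => [/codomP[t ->]|/eqP cS].
  have [ab bc] := tri_ltn t; rewrite /triset -sum1_card.
  by rewrite big_set3.
have /set0Pn[a aS] : S != set0 by rewrite -card_gt0 cS.
have : #|S :\ a| == 2 by rewrite -eqSS -cS (cardsD1 a S) aS.
case/cards2P => b [c [nbc eS]]; rewrite -(setD1K aS) eS.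
have nab : a != b by have := setD11 a S; rewrite eS !inE; case: (a == b).
have nac : a != c.
  by have := setD11 a S; rewrite eS !inE; case: (a == c); rewrite ?orbT.
(* The pair {b, c} is symmetric, so b < c may be assumed; the three possible positions of a
   remain. *)
clear -mem3 nbc nab nac; wlog bc : b c nbc nab nac / (b < c)%N.
  move=> IH; case: (ltngtP b c) => [|cb|/val_inj/eqP]; [exact: IH| |].
    2: by rewrite (negPf nbc).
  by rewrite [[set b; c]]setUC; apply: IH; rewrite // eq_sym.
case: (ltngtP a b) => [ab|ba|/val_inj/eqP]; last by rewrite (negPf nab).
  by rewrite setUA mem3 ?ab.
rewrite setUCA setUA; case: (ltngtP a c) => [ac|ca|/val_inj/eqP].
- by rewrite mem3 ?ba.
- by rewrite -setUA [[set a; c]]setUC setUA mem3 ?bc.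
- by rewrite (negPf nac).
Qed.

(** By [codom_triset] the map is onto the 3-subsets, and there are C(n, 3) of these, as many as
    triples; a surjection between finite sets of equal size is injective. *)
Lemma triset_inj : injective (@triset n).
Proof.
suff /imset_injP inj : #|[set triset t | t in {: triple_lt n}]| ==
    #|{: triple_lt n}| by move=> s t; apply: inj.
rewrite card_triple_lt -[in 'C(_, _)](card_ord n) -card_draws.
apply/eqP/eq_card => S; rewrite inE.
have := codom_triset S; rewrite inE => <-.
by apply/imsetP/codomP => [[t _ ->]|[t ->]]; exists t.
Qed.

End Triples.

(** * The matrix A in terms of boundary maps *)

Section Matrix.
Variables (k : fieldType) (d : nat).
Local Notation V := 'I_(3 * d).

(** If the pair {m, n} omits the vertex v of the triple, the two vertex signs multiply to (-1)^v.
    The incidence number is +, - or + as v comes first, second or third, which yields the exponents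
    a, b + 1 and c + 2. *)
Lemma coefE_incidence (m n : V) (t : triple_lt (3 * d)) : (m < n)%N ->
  Defs.coefE k m n t =
    vertex_sign k (triset t) * incidence k (triset t) [set m; n] *
    vertex_sign k [set m; n].
Proof.
move=> mn; have [ab bc] := tri_ltn t; rewrite /Defs.coefE /triset.
move: (tri1 t) (tri2 t) (tri3 t) ab bc => a b c ab bc.
have ac := ltn_trans ab bc.
have sgn2 (x y : V) : (x < y)%N ->
    vertex_sign k [set x; y] = (-1) ^+ x * (-1) ^+ y.
  by move=> xy; rewrite /vertex_sign big_setU1 ?big_set1 // inE neq_ltn xy.
rewrite incidence_triple // {1}/vertex_sign big_set3 // sgn2 //.
rewrite !set2_ltn_eq // -!val_eqE /=.
have sq x : (-1) ^+ x * (-1) ^+ x = 1 :> k by rewrite -expr2 sqrr_sign.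
case: (b =P m :> nat) => [bm|nbm] /=.
  have -> : (a == m :> nat) = false by rewrite -bm ltn_eqF.
  case: (c =P n :> nat) => [<-|_] /=; last by rewrite subrr addr0 mulr0 mul0r.
  by rewrite -bm subr0 addr0 mulr1 -mulrA mulrACA !sq !mulr1.
case: (a =P m :> nat) => [<-|_] /=; last by rewrite subrr addr0 mulr0 mul0r.
case: (c =P n :> nat) => [cn|_] /=.
  rewrite -cn ltn_eqF // addr0 sub0r exprS !mulrN1 mulN1r mulNr; congr (- _).
  by rewrite mulrACA sq mul1r -mulrA sq mulr1.
case: (b =P n :> nat) => [<-|_] /=; last by rewrite subrr addr0 mulr0 mul0r.
rewrite subrr add0r mulr1 !exprS !mulN1r opprK.
by rewrite mulrACA sq mul1r mulrAC sq mul1r.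
Qed.
Lemma colA_bij : bijective (@colA d).
Proof.
exists (fun t => cast_ord (card_colsA d) (enum_rank t)) => x.
  by rewrite /colA enum_valK cast_ordKV.
by rewrite /colA cast_ordK enum_rankK.
Qed.

Lemma codom_triset_colA :
  codom (fun c : 'I_(sizeA d) => triset (colA c)) =i complete3 (3 * d).
Proof.
move=> S; rewrite -codom_triset; apply/codomP/codomP => [[c ->]|[t ->]].
  by exists (colA c).
by have [f _ fK] := colA_bij; exists (f t); rewrite fK.
Qed.

Definition row_pair (r : 'I_(sizeA d)) : {set V} :=
  let p := val (rowA r).1 in
  [set widen_ord (leq_subr 1 (3 * d)) p.1; widen_ord (leq_subr 1 (3 * d)) p.2].

(** The equations with n < 3d are those of the pairs that avoid the last vertex, whose number is 3d
    - 1 when counting from 0. *)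
Lemma codom_row_pair (b : V) : (b = 3 * d - 1 :> nat)%N ->
  codom (fun r => (row_pair r, (rowA r).2)) =i
  [set x : {set V} * 'I_d | (#|x.1| == 2) && (b \notin x.1)].
Proof.
move=> b_max [P q]; rewrite inE /=; apply/codomP/andP => [[r [-> _]]|[cP bP]].
  rewrite /row_pair; case: (rowA r).1 => -[m n] /= mn.
  rewrite cards2 -val_eqE /= neq_ltn mn; split=> //.
  rewrite !inE -!val_eqE /= b_max; apply/norP.
  by split; rewrite eq_sym ltn_eqF.
have lt_b (v : V) : v \in P -> (v < 3 * d - 1)%N.
  move=> vP; rewrite ltn_neqAle -{1}b_max; apply/andP; split.
    by apply: contra bP => /eqP/val_inj <-.
  by rewrite -ltnS subn1 prednK // (leq_ltn_trans _ (ltn_ord v)).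
have [m [n [mn eP]]] : exists m n : V, (m < n)%N /\ P = [set m; n].
  case/cards2P: cP => m [n [nmn ->]].
  case: (ltngtP m n) => [mn|nm|/val_inj/eqP]; last by rewrite (negPf nmn).
    by exists m, n.
  by exists n, m; rewrite setUC.
have m_lt : (m < 3 * d - 1)%N by rewrite lt_b // eP set21.
have n_lt : (n < 3 * d - 1)%N by rewrite lt_b // eP set22.
pose p : pair_lt (3 * d - 1) := exist _ (Ordinal m_lt, Ordinal n_lt) mn.
exists (cast_ord (card_rowsA d) (enum_rank (p, q))).
rewrite /row_pair /rowA cast_ordK enum_rankK /= eP.
by congr ([set _; _], _); apply: val_inj.
Qed.

Lemma omega_vecE (H : 'I_d -> {set {set V}}) t q :
    (forall i j : 'I_d, i != j -> [disjoint H i & H j]) ->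
  omega_vec k H t q 0 = (triset t \in H q)%:R.
Proof.
move=> disH; rewrite /omega_vec; case: pickP => [q' q'P|/(_ q) ->]; last first.
  by rewrite mxE.
rewrite mxE eqxx andbT; case: (q =P q') => [-> | /eqP/disH dis].
  by rewrite q'P.
by rewrite (disjointFl dis q'P).
Qed.

(** The entry at the hyperedge T and the row (P, q) vanishes unless T lies in [H q], so linear
    independence splits over the parts. The signs are nonzero and are absorbed into the coefficients
    of the relations. *)
Lemma detS3_neq0E (b : V) (H : 'I_d -> {set {set V}}) :
    (b = 3 * d - 1 :> nat)%N -> is_dpartition H ->
  detS3 (omega k H) != 0 <->
  forall q, family_free (H q) [set P : {set V} | (#|P| == 2) && (b \notin P)]
    (@incidence k (3 * d)).
Proof.
move=> b_max [disH covH].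
pose f (T : {set V}) (x : {set V} * 'I_d) : k :=
  vertex_sign k T * incidence k T x.1 * vertex_sign k x.1 * (T \in H x.2)%:R.
(* Transposing makes the hyperedges index rows, as in [boundary]. *)
rewrite /omega detS3_pure -det_tr.
rewrite -[_ != 0]/(\det (matA (omega_vec k H))^T != 0 :> k).
rewrite -unitfE -unitmxE -row_free_unit.
have -> : (matA (omega_vec k H))^T =
    \matrix_(c, r) f (triset (colA c)) (row_pair r, (rowA r).2).
  apply/matrixP => c r; rewrite !mxE /row_pair /f.
  case: (rowA r) => -[[m n] /= mn] q.
  by rewrite omega_vecE // -coefE_incidence.
have g_inj : injective (fun c : 'I_(sizeA d) => triset (colA c)).
  by move=> c c' /triset_inj/(bij_inj colA_bij).
have rfE := row_freeE f g_inj codom_triset_colA (codom_row_pair b_max).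
apply: (iff_trans rfE).
have sumf y P q : \sum_(T in complete3 (3 * d)) y T * f T (P, q) =
    (\sum_(T in H q) y T * vertex_sign k T * incidence k T P) * vertex_sign k P.
  rewrite mulr_suml [RHS]big_mkcond [LHS]big_mkcond; apply: eq_bigr => T _.
  rewrite /f /= -covH; case: (boolP (T \in H q)) => [TH|_].
    by rewrite (subsetP (bigcup_sup q isT)) // mulr1 !mulrA.
  by rewrite !mulr0 if_same.
split=> freeH.
  move=> q y y0 T TH.
  (* A relation on [H q] is extended by zero to all hyperedges; its equations at another part q'
     hold because [H q'] and [H q] are disjoint. *)
  have := freeH (fun T => if T \in H q then y T / vertex_sign k T else 0) _ T.
  rewrite TH -covH (subsetP (bigcup_sup q isT)) // => /(_ _ isT) yT.
  apply/eqP; have /eqP : y T / vertex_sign k T = 0.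
    apply: yT => -[P q']; rewrite inE /= => GP; rewrite covH sumf.
    have [->|nq] := eqVneq q' q; last first.
      rewrite big1 ?mul0r // => S SH.
      by rewrite (disjointFr (disH _ _ nq) SH) !mul0r.
    rewrite (eq_bigr (fun S => y S * incidence k S P)) => [|S SH].
      by rewrite y0 ?mul0r // inE.
    by rewrite SH divfK // vertex_sign_neq0.
  by rewrite mulf_eq0 invr_eq0 (negPf (vertex_sign_neq0 k T)) orbF.
move=> y y0 T; rewrite -covH => /bigcupP[q _ TH].
(* Conversely, the equations with second index q involve only the coefficients on [H q]. *)
have := freeH q (fun T => y T * vertex_sign k T) _ T TH => yT.
apply/eqP; have /eqP : y T * vertex_sign k T = 0.
  apply: yT => P GP; have := y0 (P, q); rewrite sumf !inE /=.
  move=> /(_ _)/eqP; rewrite mulf_eq0 (negPf (vertex_sign_neq0 k P)) orbF.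
  by move=> yP; apply/eqP/yP; rewrite inE in GP.
by rewrite mulf_eq0 (negPf (vertex_sign_neq0 k T)) orbF.
Qed.

End Matrix.

(** * Counting hyperedges in the parts of a partition *)

Lemma card_pairs_avoiding (n : nat) (b : 'I_n) :
  #|[set P : {set 'I_n} | (#|P| == 2) && (b \notin P)]| = 'C(n - 1, 2).
Proof.
have <- : #|~: [set b]| = (n - 1)%N by rewrite cardsCs setCK cards1 card_ord.
rewrite -cards_draws; apply: eq_card => P; rewrite !inE andbC; congr (_ && _).
by rewrite -disjoints1 disjoint_sym disjoints_subset.
Qed.

(** The rows of A run over all pairs avoiding the last vertex, the columns of [boundary] only over
    faces; at a pair that is not a face the equation reads 0 = 0. *)
Lemma family_free_Eset (k : fieldType) (n : nat) (H : {set {set 'I_n}}) s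
    (b : 'I_n) :
  family_free H [set P in Eset s H | b \notin P] (@incidence k n) <->
  family_free H [set P : {set 'I_n} | (#|P| == s) && (b \notin P)]
    (@incidence k n).
Proof.
split=> freeH y y0; apply: freeH => P; rewrite inE.
  by rewrite inE -andbA => /and3P[cP _ bP]; rewrite y0 // inE cP.
case/andP=> /eqP cP bP; case: (boolP (P \in Eset s H)) => PE.
  by rewrite y0 // inE PE.
by apply: boundary_notin_Eset; rewrite cP.
Qed.

Section Partition.
Variables (k : fieldType) (d : nat) (H : 'I_d -> {set {set 'I_(3 * d)}}).
Hypotheses (d_gt0 : (0 < d)%N) (H_part : is_dpartition H).

Lemma dpartition_sub q : H q \subset complete3 (3 * d).
Proof. by case: H_part => _ <-; apply: bigcup_sup. Qed.

Lemma dpartition_card q T : T \in H q -> #|T| = 3.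
Proof. by move/(subsetP (dpartition_sub q)); rewrite inE => /eqP. Qed.

Lemma detS3_neq0P :
  detS3 (omega k H) != 0 <-> forall q, row_free (boundary k (H q) 2).
Proof.
have b_lt : (3 * d - 1 < 3 * d)%N by rewrite subn1 prednK // muln_gt0.
have E := detS3_neq0E k (erefl : Ordinal b_lt = 3 * d - 1 :> nat)%N H_part.
apply: (iff_trans E); split=> freeH q.
  apply/(row_free_boundaryP k (Ordinal b_lt) (@dpartition_card q)).
  exact/family_free_Eset.
apply/family_free_Eset.
exact/(row_free_boundaryP k (Ordinal b_lt) (@dpartition_card q)).
Qed.

Hypothesis freeH : forall q, row_free (boundary k (H q) 2).

(** Independent rows cannot outnumber columns. Keeping [b] free is what lets [Eset2_full] choose it
    outside a missing edge. *)
Lemma card_hyperedges_le q (b : 'I_(3 * d)) :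
  (#|H q| <= #|[set P in Eset 2 (H q) | b \notin P]|)%N.
Proof.
apply: (@family_free_card k).
exact/(row_free_boundaryP k b (@dpartition_card q)).
Qed.

Lemma card_hyperedges q : #|H q| = 'C(3 * d - 1, 2).
Proof.
have n_gt0 : (0 < 3 * d)%N by rewrite muln_gt0.
have le_bin i :
    (#|H i| <= 'C(3 * d - 1, 2) ?= iff (#|H i| == 'C(3 * d - 1, 2)))%N.
  split=> //; apply: leq_trans (card_hyperedges_le i (Ordinal n_gt0)) _.
  rewrite -(card_pairs_avoiding (Ordinal n_gt0)); apply: subset_leq_card.
  by apply/subsetP => P; rewrite !inE -andbA => /and3P[-> _ ->].
(* Equality of the totals will force equality in each of the d bounds. *)
have [_] := leqif_sum (fun i (_ : predT i) => le_bin i).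
rewrite sum_nat_const card_ord.
(* The parts together contain C(3d, 3) hyperedges, which is d C(3d-1, 2): this is the squareness of
   A, recorded in [card_colsA]. *)
have -> : (\sum_i #|H i| = d * 'C(3 * d - 1, 2))%N.
  case: H_part => disH covH.
  under eq_bigr do rewrite -sum1_card.
  rewrite -(partition_disjoint_bigcup _ (fun=> 1%N) disH) covH sum1_card.
  by rewrite card_draws card_ord -card_triple_lt card_colsA.
by rewrite eqxx => /esym/forallP/(_ q)/eqP.
Qed.

Lemma Eset2_full q : Eset 2 (H q) = [set P : {set 'I_(3 * d)} | #|P| == 2].
Proof.
apply/setP => P; rewrite [RHS]inE; apply/idP/idP => [|cP].
  by rewrite inE => /andP[].
apply/negPn/negP => nPE.
(* Since 3d > 2, some vertex b lies outside the missing edge P. Then P avoids b but is not counted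
   in the bound at b, which drops strictly below C(3d-1, 2). *)
have /subsetPn[b _ bP] : ~~ ([set: 'I_(3 * d)] \subset P).
  apply/negP => /subset_leq_card; rewrite cardsT card_ord (eqP cP).
  by rewrite leqNgt (leq_trans _ (leq_pmulr 3 d_gt0)).
have := card_hyperedges_le q b; rewrite leqNgt => /negP; apply.
rewrite card_hyperedges -(card_pairs_avoiding b).
apply: proper_card; apply/properP; split.
  by apply/subsetP => Q; rewrite !inE -andbA => /and3P[-> _ ->].
by exists P; rewrite inE ?cP ?bP // (negPf nPE).
Qed.

Lemma Eset1_full q : Eset 1 (H q) = [set P : {set 'I_(3 * d)} | #|P| == 1].
Proof.
apply/setP => S; rewrite !inE; case: (boolP (#|S| == 1)) => //= /cards1P[a ->].
have /subsetPn[b _ ab] : ~~ ([set: 'I_(3 * d)] \subset [set a]).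
  apply/negP => /subset_leq_card; rewrite cardsT card_ord cards1.
  by rewrite leqNgt (leq_trans _ (leq_pmulr 3 d_gt0)).
(* The vertex a lies on the edge {a, b}, hence on any hyperedge containing that edge. *)
have : [set a; b] \in Eset 2 (H q).
  by rewrite Eset2_full inE cards2; move: ab; rewrite inE eq_sym => ->.
rewrite inE => /andP[_ /exists_inP[T TH abT]]; apply/exists_inP; exists T => //.
by rewrite sub1set (subsetP abT) // set21.
Qed.

End Partition.

Theorem theorem4p11 (k : fieldType) (k_char0 : [pchar k] =i pred0)
    (d : nat) (d_ge2 : (2 <= d)%N)
    (H : 'I_d -> {set {set 'I_(3 * d)}}) (H_part : is_dpartition H) :
  [<-> detS3 (omega k H) != 0;
       pre_homogeneous H /\
         (forall (i : 'I_d) (q : int), -1 <= q <= 2 -> betti k (H i) q = 0%N);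
       pre_homogeneous H /\
         (forall i : 'I_d, betti k (H i) 2 = 0%N)].
Proof.
have d_gt0 : (0 < d)%N := ltnW d_ge2.
have detP := detS3_neq0P k d_gt0 H_part.
tfae.
- move/detP => freeH; have E1 := Eset1_full d_gt0 H_part freeH.
  have E2 := Eset2_full d_gt0 H_part freeH; split=> i.
    by rewrite E1 E2 !card_draws card_ord bin1 bin2 subn1 divn2.
  move=> q; apply: betti_acyclic => //.
  + by rewrite muln_gt0.
  + exact: dpartition_sub.
  + exact: card_hyperedges.
- by case=> pre b0; split=> // i; apply: b0.
(* Closes the cycle: b_2 = 0 makes the boundary map of each part injective, which is the criterion
   [detP]. *)
- case=> _ b2; apply/detP => q; apply/betti2_eq0; last exact: b2.
  exact: dpartition_sub.
Qed.
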